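(* Let $(a_1,a_2,\ldots,a_{2m})$ be a sequence of positive integers and let $(c_1,\ldots,c_k)$ be a sequence of integers greater than $1$. Then $$\text{(i)}\quad R^{+}(a_1,\ldots,a_{2m})_{q}=\sum_{\gamma\text{ in }\mathbb{T}^{+}}q^{\mathrm{ar}(\gamma)}=\sum_{\gamma\text{ in }\mathbb{T}^{+}}q^{\mathrm{coar}(\gamma)},$$ $$\text{(ii)}\quad R(c_1,\ldots,c_k)_q=\sum_{\gamma\text{ in }\mathbb{T}^{-}}q^{\mathrm{ar}(\gamma)}=\sum_{\gamma\text{ in }\mathbb{T}^{-}}q^{\mathrm{coar}(\gamma)},$$ where the sums run over all oriented closed loops $\gamma$ in the triangulations $\mathbb{T}^+=\mathbb{T}^{+}(a_1,\ldots,a_{2m})$ and $\mathbb{T}^-=\mathbb{T}^{-}(c_1,\ldots,c_k)$, respectively.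
   Context: $q$-integers: for a positive integer $a$, $[a]_q=1+q+\cdots+q^{a-1}$ and $[a]_{q^{-1}}=1+q^{-1}+\cdots+q^{-(a-1)}$. $q$-rotundi: $R^+(a_1,\ldots,a_{2m})_q=\mathrm{Tr}\,M^+(a_1,\ldots,a_{2m})_q$ and $R(c_1,\ldots,c_k)_q=\mathrm{Tr}\,M(c_1,\ldots,c_k)_q$, where $$M^+(a_1,\ldots,a_{2m})_q=q^{a_2+a_4+\cdots+a_{2m}}\begin{pmatrix}[a_1]_q&q^{a_1}\\1&0\end{pmatrix}\begin{pmatrix}[a_2]_{q^{-1}}&q^{-a_2}\\1&0\end{pmatrix}\cdots\begin{pmatrix}[a_{2m-1}]_q&q^{a_{2m-1}}\\1&0\end{pmatrix}\begin{pmatrix}[a_{2m}]_{q^{-1}}&q^{-a_{2m}}\\1&0\end{pmatrix},$$ $$M(c_1,\ldots,c_k)_q=\begin{pmatrix}[c_1]_q&-q^{c_1-1}\\1&0\end{pmatrix}\cdots\begin{pmatrix}[c_k]_q&-q^{c_k-1}\\1&0\end{pmatrix}.$$ Fan triangulation $\mathbb T$ with parameters $(a_1,\ldots,a_{2m})$, $a_i\ge1$: put $k=a_2+a_4+\cdots+a_{2m}$, $\ell=a_1+a_3+\cdots+a_{2m-1}$, $n=k+\ell+2$. It is a triangulated $n$-gon (drawn in a horizontal strip) with top vertices, from left to right, $1,2,\ldots,k+1$ and bottom vertices, from left to right, $0,n-1,n-2,\ldots,k+2$. From left to right, starting at the edge $\{0,1\}$ and ending at the edge $\{k+1,k+2\}$,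 it consists of $a_1$ adjacent triangles ''base down'' (two consecutive bottom vertices and one top vertex), then $a_2$ adjacent triangles ''base up'' (two consecutive top vertices and one bottom vertex), then $a_3$ base down, $a_4$ base up, and so on. Let $c_i$ ($1\le i\le k$) be the number of triangles incident to vertex $i$; then $$(c_1,\ldots,c_k)=(a_1+1,\underbrace{2,\ldots,2}_{a_2-1},a_3+2,\underbrace{2,\ldots,2}_{a_4-1},\ldots,a_{2m-1}+2,\underbrace{2,\ldots,2}_{a_{2m}-1}),$$ and each sequence $(c_1,\ldots,c_k)$ of integers $\ge2$ arises from a unique $(a_1,\ldots,a_{2m})$; so $\mathbb T$ is also determined by $(c_1,\ldots,c_k)$. Orientation of $\mathbb T$: every edge joining two consecutive top vertices or two consecutive bottom vertices is oriented leftward. Every edge joining a top and a bottom vertex, other than $\{0,1\}$, is oriented upward (bottom to top) if the triangle immediately to its left is base down, and downward (top to bottom) if the triangle immediately to its left is base up; in particular $\{k+1,k+2\}$ is oriented $k+1\to k+2$. The edge $\{0,1\}$ has no orientation. $C_{\ell',k}$ denotes an annulus (region bounded by two concentric circles) with $\ell'$ marked points on the outer circle and $k$ marked points on the inner circle. $\mathbb T^+(a_1,\ldots,a_{2m})$: the oriented triangulation of $C_{n-k-2,k}$ obtained from the fan triangulation $\mathbb T$ with parameters $(a_1,\ldots,a_{2m})$ by gluing the edge $\{0,1\}$ onto the edge $\{k+1,k+2\}$ without flipping, with $1$ glued on $k+1$ and $0$ glued on $k+2$, the resulting arc having the orientation $k+1\to k+2$. The top vertices $1,\ldots,k$ become the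 marked points on the inner boundary, the bottom vertices $k+2,\ldots,n-1$ become the marked points on the outer boundary. $\mathbb T^-(c_1,\ldots,c_k)$: the oriented triangulation of $C_{n-k-3,k}$ obtained from the fan triangulation $\mathbb T$ determined by $(c_1,\ldots,c_k)$ by gluing the triangle $\{0,1,n-1\}$ onto the triangle $\{k,k+1,k+2\}$, with $0,1,n-1$ glued respectively on $k,k+1,k+2$, the orientation being that of the edges of $\{k,k+1,k+2\}$. Equivalently, one deletes the triangle $\{0,1,n-1\}$ and glues the edge $\{1,n-1\}$ onto $\{k+1,k+2\}$ ($1$ on $k+1$, $n-1$ on $k+2$), the resulting arc being oriented $k+1\to k+2$. The inner boundary carries the $k$ marked points coming from the top vertices, and the outer boundary the $n-k-3=\sum_i(c_i-2)$ marked points coming from the bottom vertices. Closed loops: an oriented closed loop is a closed loop with no self-crossing obtained by concatenating oriented arcs of the triangulation consistently with their orientations (i.e. a directed cycle of arcs passing at most once through each marked point, considered up to the choice of starting point). For such a loop $\gamma$, $\mathrm{ar}(\gamma)$ is the number of triangles enclosed between $\gamma$ and the inner boundary, and $\mathrm{coar}(\gamma)$ is the number of triangles enclosed between $\gamma$ and the outer boundary.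
   Formalization: When all c_i = 2 the outer boundary has no marked points and (ii) fails as written (R = 1+q^k, but the only oriented closed loop is the inner circle); there the formal statement also counts the outer boundary circle, made of no arcs, as a closed loop. *)

(* Defs.v *)
From mathcomp Require Import all_boot all_order all_algebra.
From mathcomp Require Import zify.

Set Implicit Arguments.
Unset Strict Implicit.
Unset Printing Implicit Defensive.

Import GRing.Theory.

Section Rotundi.

Local Open Scope ring_scope.

Variable K : comUnitRingType.

Definition qint (q : K) (a : nat) : K := \sum_(i < a) q ^+ i.

Definition mx22 (a b c d : K) : 'M[K]_2 :=
  \matrix_(i, j) if i == 0 then (if j == 0 then a else b)
                 else (if j == 0 then c else d).

(* Sequences are indexed from 0, so the entries a_2, a_4, ... of
   (a_1, ..., a_2m) are the ones of odd index. *)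
Definition Mplus (q : K) (a : seq nat) : 'M[K]_2 :=
  q ^+ (\sum_(i < size a | odd i) nth 0%N a i) *:
  \prod_(i < size a)
    (let x := nth 0%N a i in
     if odd i then mx22 (qint q^-1 x) (q ^- x) 1 0
     else mx22 (qint q x) (q ^+ x) 1 0).

Definition rotundus_plus (q : K) (a : seq nat) : K := \tr (Mplus q a).

Definition Mminus (q : K) (c : seq nat) : 'M[K]_2 :=
  \prod_(i < size c)
    (let x := nth 0%N c i in mx22 (qint q x) (- q ^+ x.-1) 1 0).

Definition rotundus (q : K) (c : seq nat) : K := \tr (Mminus q c).

End Rotundi.

(* Oriented triangulations of an annulus, possibly with several arcs between
   the same marked points, and with loops. *)
Record triangulation := Triangulation {
  point : finType;
  arc : finType;
  triangle : finType;
  source : arc -> point;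
  target : arc -> point;
  sides : triangle -> {set arc};
  inner_points : {set point};
  outer_points : {set point};
  inner_arcs : {set arc};
  outer_arcs : {set arc} }.

Section Loops.

Variable T : triangulation.

Definition corners (t : triangle T) : {set point T} :=
  [set source e | e in sides t] :|: [set target e | e in sides t].

(* A closed loop is recorded by the set of marked points and the set of arcs
   it passes through.  As a directed cycle visiting each marked point at most
   once is determined by its set of arcs, this is the same as a cyclic sequence
   of arcs up to the choice of starting point. *)
Definition loop : finType := ({set point T} * {set arc T})%type.

(* The last alternative is for an outer boundary circle without marked point
   (annulus C_{0,k}, which arises from the sequences c = (2, ..., 2)).  The
   gluing shrinks that circle to a single point, and the circle itself is then
   a closed loop composed of no arc at all. *)
Definition closed_loop (g : loop) : bool :=
  [exists l : 'I_#|arc T|.+1, exists s : l.-tuple (arc T),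
     [&& 0 < l, cycle [rel e f | target e == source f] s,
         uniq [seq source e | e <- s]
       & g == ([set source e | e in s], [set e in s])]]
  || [&& outer_arcs T == set0 & g == (outer_points T, set0)].

(* Triangles are glued along the arcs that are not on the loop g, so that
   connectedness is connectedness in the complement of g. *)
Definition off_loop (g : loop) : rel (triangle T) :=
  [rel t u | ~~ (sides t :&: sides u \subset g.2)].

(* Triangles enclosed between g and the boundary circle made of the marked
   points P and of the arcs A: the complement of g connects them to a point of
   this circle that is not on g. *)
Definition enclosed (P : {set point T}) (A : {set arc T}) (g : loop)
    : {set triangle T} :=
  [set t | [exists u, connect (off_loop g) t u &&
     (~~ (corners u :&: P \subset g.1) || ~~ (sides u :&: A \subset g.2))]].

Definition ar (g : loop) : nat :=
  #|enclosed (inner_points T) (inner_arcs T) g|.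

Definition coar (g : loop) : nat :=
  #|enclosed (outer_points T) (outer_arcs T) g|.

End Loops.

(* The triangles of the fan triangulation, from left to right:
   [true] is base up, [false] is base down. *)
Definition fan_word (a : seq nat) : seq bool :=
  flatten [seq nseq (nth 0 a i) (odd i) | i <- iota 0 (size a)].

Section GluedFan.

Variables (w : seq bool) (d : nat).

Let k := count id w.
Let n := (size w).+2.

(* The edges joining the top and the bottom are numbered from left to right by
   0, ..., size w, the j-th triangle (j >= 0) lying between the edges j and j+1.
   [vertex true j] and [vertex false j] are the top and the bottom endpoints of
   the edge j, with the labels 1, ..., k+1 for the top vertices and
   0, n-1, ..., k+2 for the bottom vertices. *)
Definition vertex (up : bool) (j : nat) : 'I_n :=
  if up then inord (count id (take j w)).+1
  else inord ((n - count negb (take j w)) %% n).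

(* After deletion of the first d triangles, the leftmost edge is the edge d; it
   is glued onto the edge {k+1, k+2}, top on top and bottom on bottom.  The
   glued vertices keep the labels 1 and k+2. *)
Definition glue (v : 'I_n) : 'I_n :=
  if v == inord k.+1 then inord 1
  else if v == vertex false d then inord k.+2 else v.

Definition base_up (t : 'I_(size w - d)) : bool := nth false w (d + t).

(* [inl t] is the right side of the triangle t and [inr t] is its base.  The
   left side of t is the right side of its left neighbour; by the gluing, the
   left neighbour of the first triangle is the last one.  The right side goes
   upward if t is base down and downward if t is base up; bases go leftward. *)
Definition fan_arc : finType := ('I_(size w - d) + 'I_(size w - d))%type.

Definition fan_source (e : fan_arc) : 'I_n :=
  match e with
  | inl t => glue (vertex (base_up t) (d + t).+1)
  | inr t => glue (vertex (base_up t) (d + t).+1)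
  end.

Definition fan_target (e : fan_arc) : 'I_n :=
  match e with
  | inl t => glue (vertex (~~ base_up t) (d + t).+1)
  | inr t => glue (vertex (base_up t) (d + t))
  end.

Definition fan_sides (t : 'I_(size w - d)) : {set fan_arc} :=
  [set inl (ord_pred t); inl t; inr t].

Definition fan_boundary_points (up : bool) : {set 'I_n} :=
  [set glue (vertex up (val j)) | j : 'I_(size w).+1 & d <= j].

Definition fan_boundary_arcs (up : bool) : {set fan_arc} :=
  [set inr t | t : 'I_(size w - d) & base_up t == up].

Definition glued_fan : triangulation :=
  Triangulation fan_source fan_target fan_sides
    (fan_boundary_points true) (fan_boundary_points false)
    (fan_boundary_arcs true) (fan_boundary_arcs false).

End GluedFan.

Definition Tplus (a : seq nat) : triangulation := glued_fan (fan_word a) 0.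

(* Numbers of triangles at the top vertices 1, ..., k of the fan triangulation
   with parameters a:
   (a_1 + 1, 2^(a_2 - 1), a_3 + 2, 2^(a_4 - 1), ...). *)
Fixpoint quiddity_from (e : nat) (a : seq nat) : seq nat :=
  if a is x :: y :: a' then
    (x + e) :: nseq y.-1 2 ++ quiddity_from 2 a'
  else [::].

Definition quiddity (a : seq nat) : seq nat := quiddity_from 1 a.

(* The inverse of [quiddity]; x and y are the pair of parameters being read. *)
Fixpoint fan_params_from (x y : nat) (c : seq nat) : seq nat :=
  if c is z :: c' then
    if z == 2 then fan_params_from x y.+1 c'
    else x :: y :: fan_params_from (z - 2) 1 c'
  else [:: x; y].

Definition fan_params (c : seq nat) : seq nat :=
  if c is z :: c' then fan_params_from z.-1 1 c' else [::].

Lemma fan_paramsP (c : seq nat) :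
  c != [::] -> all (leq 2) c ->
  [/\ ~~ odd (size (fan_params c)), all (leq 1) (fan_params c)
    & quiddity (fan_params c) = c].
Proof.
have aux c' : all (leq 2) c' -> forall x y e, 0 < x -> 0 < y ->
    [/\ ~~ odd (size (fan_params_from x y c')),
        all (leq 1) (fan_params_from x y c')
      & quiddity_from e (fan_params_from x y c')
        = (x + e) :: nseq y.-1 2 ++ c'].
  elim: c' => [_ x y e x0 y0|z c' IH /= /andP[z2 hc] x y e x0 y0].
    by rewrite /= x0 y0.
  case: eqP => [->|/eqP zn2].
    have [-> -> ->] := IH hc x y.+1 e x0 isT; split=> //=.
    by case: y y0 => // y _ /=; elim: y => //= y [->].
  have z0 : 0 < z - 2 by lia.
  have [/= h1 h2 ->] := IH hc (z - 2) 1 2 z0 isT.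
  by rewrite /= negbK h1 x0 y0 h2 /= subnK.
case: c => //= z c _ /andP[z2 hc].
have z0 : 0 < z.-1 by lia.
have [h1 h2 h3] := aux c hc z.-1 1 1 z0 isT.
split=> //; rewrite /quiddity h3 /= addn1 prednK //; lia.
Qed.

Lemma quiddityK (a : seq nat) :
  a != [::] -> ~~ odd (size a) -> all (leq 1) a -> fan_params (quiddity a) = a.
Proof.
have tw x n y s : fan_params_from x y (nseq n 2 ++ s) =
                  fan_params_from x (y + n) s.
  by elim: n y => [|n IH] y /=; rewrite ?addn0 // IH addSnnS.
have aux m : forall a' x y, size a' <= m -> ~~ odd (size a') ->
    all (leq 1) a' ->
    fan_params_from x y (quiddity_from 2 a') = x :: y :: a'.
  elim: m => [|m IH] [|u [|v a']] x y //= sz od /and3P[u0 v0 ha].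
  case: eqP => [|_]; first by lia.
  rewrite tw IH //; first by rewrite addnK add1n prednK.
  - by lia.
  - by rewrite negbK in od.
case: a => [|x [|y a]] //= _ od /and3P[x0 y0 ha].
rewrite tw addn1 /= add1n prednK // (aux (size a)) //.
by rewrite negbK in od.
Qed.

(* Deleting the first triangle {0, 1, n-1} and then gluing. *)
Definition Tminus (c : seq nat) : triangulation :=
  glued_fan (fan_word (fan_params c)) 1.

(* Main.v *)
Require Import Defs.
From mathcomp Require Import all_boot all_order all_algebra.
From mathcomp Require Import zify ring.

Set Implicit Arguments.
Unset Strict Implicit.
Unset Printing Implicit Defensive.

Import GRing.Theory.

(** Cut the annulus along the edges that join its two circles, and number the
    triangles from left to right by 0, ..., n - 1, edge t being the right side of
    triangle t.  Horizontal arcs go leftward, so that a closed loop travels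
    leftward around the annulus.  Let s t tell at which end of edge t (top for
    true, bottom for false) it arrives there.  If this end is the apex of the
    triangle t, the loop stays there: no arc leaves it between the edges t and
    t - 1.  If it is the right end of the base of t, the loop either follows the
    base or follows the edge t to the apex: these are the only two arcs that leave
    this vertex, and the orientation of the edge t is what makes the second one
    possible.  Hence the closed loops are exactly the functions s on the cyclic
    sequence of edges such that s (t - 1) = s t whenever s t is the apex of t;
    such an s is called a passage below ([closed_passage_loop],
    [closed_loop_passage], [passage_loop_inj]).  If the outer circle is a single
    point, the constant s = bottom is this circle, a loop without arc.

    That a loop winds around only once is not part of its definition.  One step
    from the edge t to the edge t - 1 acts on the pair of ends {top, bottom} either
    as the identity or as a constant map, never as the exchange of the two.  So does
    a full turn, and a map of this kind fixes all its periodic points: a loop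
    closes up after one turn ([iter_walk_full]).

    The loop cuts the annulus along s: the triangle t lies on the inner side
    exactly when s (t - 1) is bottom ([enclosed_passage]).  Therefore
    the sum of q ^ ar over all loops is a sum over closed walks of length n in a
    graph with two vertices, that is, the trace of a product of n transfer
    matrices, one for each triangle, with two possible values according to whether
    the triangle is base up or base down.  The same holds for coar, with two other
    matrices ([loop_sum_trace]).

    The rotundi are also traces of words in two matrices, along the same word
    ([rotundus_plus_word], [rotundus_word]).  Now the trace of a word in two
    matrices X, Y of size two is determined by the traces and determinants of X and
    Y and by the trace of X Y, a theorem of Fricke ([trace_word]).  In all the cases
    above these five numbers are 1 + q, 1 + q, q, q and 1 + q + q ^ 2, and this gives
    all the equalities. *)

(** * Words in two matrices of size two *)

Section TwoByTwo.

Local Open Scope ring_scope.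

Variable K : comUnitRingType.
Implicit Types (a b c d e : K) (X Y : 'M[K]_2).

Lemma mx22_eta X : X = mx22 (X 0 0) (X 0 1) (X 1 0) (X 1 1).
Proof.
apply/matrixP=> i j; rewrite !mxE.
by case: i => [[|[|//]] ?]; case: j => [[|[|//]] ?]; congr (X _ _); apply/val_inj.
Qed.

Lemma mulmx22 a b c d a' b' c' d' :
  mx22 a b c d * mx22 a' b' c' d' =
  mx22 (a * a' + b * c') (a * b' + b * d') (c * a' + d * c') (c * b' + d * d').
Proof.
apply/matrixP=> i j; rewrite !mxE !big_ord_recl big_ord0 addr0 !mxE /=.
by case: i => [[|[|//]] ?]; case: j => [[|[|//]] ?].
Qed.

Lemma addmx22 a b c d a' b' c' d' :
  mx22 a b c d + mx22 a' b' c' d' = mx22 (a + a') (b + b') (c + c') (d + d').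
Proof. by apply/matrixP=> i j; rewrite !mxE; case: ifP; case: ifP. Qed.

Lemma scalemx22 e a b c d :
  e *: mx22 a b c d = mx22 (e * a) (e * b) (e * c) (e * d).
Proof. by apply/matrixP=> i j; rewrite !mxE; case: ifP; case: ifP. Qed.

Lemma scalar_mx22 e : e%:M = mx22 e 0 0 e.
Proof.
apply/matrixP=> i j; rewrite !mxE.
by case: i => [[|[|//]] ?]; case: j => [[|[|//]] ?].
Qed.

Lemma mxtrace22 a b c d : \tr (mx22 a b c d) = a + d.
Proof. by rewrite /mxtrace !big_ord_recl big_ord0 !mxE /= addr0. Qed.

Lemma det_mx22 a b c d : \det (mx22 a b c d) = a * d - b * c.
Proof.
rewrite (expand_det_row _ 0) !big_ord_recl big_ord0 /cofactor !det_mx11 !mxE /=.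
by rewrite addr0 expr0 expr1 mul1r mulN1r mulrN.
Qed.

Definition mx22E := (mulmx22, addmx22, scalemx22, scalar_mx22, mxtrace22, det_mx22).

Definition word_mx X Y (w : seq bool) : 'M[K]_2 :=
  \prod_(b <- w) (if b then X else Y).

(** By the Cayley-Hamilton theorem, the algebra generated by X and Y is spanned by
    1, X, Y and X Y. *)
Definition span4 X Y a b c d : 'M[K]_2 := a%:M + b *: X + c *: Y + d *: (X * Y).

Lemma mul_span4l X Y a b c d :
  X * span4 X Y a b c d =
  span4 X Y (- b * \det X) (a + b * \tr X) (- d * \det X) (c + d * \tr X).
Proof.
rewrite /span4 (mx22_eta X) (mx22_eta Y) !mx22E.
by congr mx22; ring.
Qed.

(** Here Y X is eliminated by polarizing the Cayley-Hamilton identity: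
    X Y + Y X = tr X . Y + tr Y . X + (tr (X Y) - tr X tr Y). *)
Lemma mul_span4r X Y a b c d :
  Y * span4 X Y a b c d =
  span4 X Y (b * (\tr (X * Y) - \tr X * \tr Y) - c * \det Y - d * (\tr X * \det Y))
            (b * \tr Y + d * \det Y)
            (a + b * \tr X + c * \tr Y + d * \tr (X * Y)) (- b).
Proof.
rewrite /span4 (mx22_eta X) (mx22_eta Y) !mx22E.
by congr mx22; ring.
Qed.

(** Fricke: the coefficients of a word on 1, X, Y, X Y are computed by a recursion
    that involves only the five given numbers, hence are common to both pairs. *)
Lemma trace_word X Y X' Y' w :
    \tr X = \tr X' -> \tr Y = \tr Y' -> \det X = \det X' -> \det Y = \det Y' ->
    \tr (X * Y) = \tr (X' * Y') ->
  \tr (word_mx X Y w) = \tr (word_mx X' Y' w).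
Proof.
move=> trX trY detX detY trXY.
suff [a [b [c [d [-> ->]]]]] : exists a b c d,
    word_mx X Y w = span4 X Y a b c d /\ word_mx X' Y' w = span4 X' Y' a b c d.
  by rewrite /span4 !linearD /= !linearZ /= trX trY trXY.
rewrite /word_mx; elim: w => [|[] w [a [b [c [d [IH IH']]]]]].
- exists 1, 0, 0, 0; rewrite !big_nil /span4.
  by rewrite !scale0r !addr0.
- by rewrite !big_cons IH IH' !mul_span4l trX detX; do 4 eexists; split.
- rewrite !big_cons IH IH' !mul_span4r trX trY detY trXY.
  by do 4 eexists; split.
Qed.

Lemma word_mx_cat X Y w w' : word_mx X Y (w ++ w') = word_mx X Y w * word_mx X Y w'.
Proof. by rewrite /word_mx big_cat. Qed.

Lemma word_mx_nseq X Y (b : bool) n :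
  word_mx X Y (nseq n b) = (if b then X else Y) ^+ n.
Proof.
by elim: n => [|n IH]; rewrite /word_mx ?big_nil // big_cons exprS -IH.
Qed.

End TwoByTwo.

(** * Rotundi as traces of words *)

Lemma fan_word_cons2 x y a :
  fan_word [:: x, y & a] = nseq x false ++ nseq y true ++ fan_word a.
Proof.
rewrite /fan_word /= (iotaDl 2 0) -map_comp; congr (_ ++ (_ ++ flatten _)).
by apply: eq_map => i /=; rewrite negbK.
Qed.

(** After its first triangle, the fan with quiddity c is a sequence of blocks, one
    for each c_i: c_i - 2 triangles base down, then one base up. *)
Lemma fan_word_params z c : all (leq 2) (z :: c) ->
  fan_word (fan_params (z :: c)) =
  false :: flatten [seq rcons (nseq (y - 2) false) true | y <- z :: c].
Proof.
have aux x y : fan_word (fan_params_from x y c) = nseq x false ++ nseq y true ++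
    flatten [seq rcons (nseq (u - 2) false) true | u <- c].
  elim: c x y => [|u c IH] x y /=; first by rewrite fan_word_cons2.
  case: eqP => [->|_]; last by rewrite fan_word_cons2 IH cat_rcons.
  rewrite IH; congr (_ ++ _) => /=.
  by elim: y {IH} => //= y ->.
case: z => [|[|z]] //= _; rewrite aux /= cat_rcons.
by rewrite subSS subSS subn0.
Qed.

Section Rotundi.

Local Open Scope ring_scope.

Variables (K : comUnitRingType) (q : K).
Hypothesis hq : q \is a GRing.unit.

Lemma qintS n : qint q n.+1 = qint q n + q ^+ n.
Proof. by rewrite /qint big_ord_recr. Qed.

Lemma qintSl n : qint q n.+1 = 1 + q * qint q n.
Proof.
rewrite /qint big_ord_recl expr0 mulr_sumr; congr (_ + _).
by apply: eq_bigr => i _; rewrite exprS.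
Qed.

Lemma qint_inv n : q ^+ n * qint q^-1 n = q * qint q n.
Proof.
elim: n => [|n IH]; first by rewrite /qint !big_ord0 !mulr0.
rewrite {1}/qint big_ord_recr /= -/(qint _ _) mulrDr exprS -mulrA IH exprVn.
by rewrite -mulrA divrr ?unitrX // mulr1 [in RHS]qintSl mulrDr mulr1 addrC.
Qed.

Lemma expr_upper22 n : (mx22 1 q 0 q : 'M[K]_2) ^+ n = mx22 1 (q * qint q n) 0 (q ^+ n).
Proof.
elim: n => [|n IH]; first by rewrite expr0 /qint big_ord0 mulr0 -scalar_mx22.
rewrite exprSr IH mulmx22 qintSl exprSr; congr mx22; ring.
Qed.

Lemma expr_lower22 n : (mx22 1 0 1 q : 'M[K]_2) ^+ n = mx22 1 0 (qint q n) (q ^+ n).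
Proof.
elim: n => [|n IH]; first by rewrite expr0 /qint big_ord0 -scalar_mx22.
rewrite exprSr IH mulmx22 qintS exprSr; congr mx22; ring.
Qed.

Lemma expr_affine22 n : (mx22 q 1 0 1 : 'M[K]_2) ^+ n = mx22 (q ^+ n) (qint q n) 0 1.
Proof.
elim: n => [|n IH]; first by rewrite expr0 /qint big_ord0 -scalar_mx22.
rewrite exprSr IH mulmx22 qintS exprSr; congr mx22; ring.
Qed.

(** The matrix of c_i in M(c) is D ^ (c_i - 2) U, where U is the matrix of 2 and D is
    chosen so that D U is the matrix of 3. *)
Lemma rotundus_word c : all (leq 2) c -> c != [::] ->
  rotundus q c = \tr (word_mx (mx22 (1 + q) (- q) 1 0) (mx22 q 1 0 1)
                        (behead (fan_word (fan_params c)))).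
Proof.
case: c => // z c hc _; rewrite fan_word_params // /rotundus /Mminus.
rewrite [behead _]/(flatten [seq rcons (nseq (y - 2) false) true | y <- z :: c]).
set cc := (z :: c) in hc *; congr (\tr _).
rewrite -(big_mkord xpredT (fun i => mx22 (qint q (nth 0 cc i)) (- q ^+ (nth 0 cc i).-1) 1 0)).
rewrite -(big_nth 0%N xpredT (fun x => mx22 (qint q x) (- q ^+ x.-1) 1 0)).
elim: cc hc => [|x s IH] /=; first by rewrite /word_mx !big_nil.
case/andP=> x2 hs; rewrite big_cons IH // word_mx_cat; congr (_ * _).
rewrite -cats1 word_mx_cat word_mx_nseq expr_affine22 /word_mx big_seq1 mulmx22.
case: x x2 => [|[|n]] // _; rewrite subSS subSS subn0 !qintS exprS /=.
by congr mx22; ring.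
Qed.

(** With J the exchange of the two coordinates, the matrices of the pair (x, y) are
    J D ^ x and U ^ y J, up to the factor q ^ y for the second one; consecutive
    factors J cancel, and the two extreme ones cancel in the trace. *)
Lemma rotundus_plus_word a : ~~ odd (size a) ->
  rotundus_plus q a =
  \tr (word_mx (mx22 1 q 0 q) (mx22 1 0 1 q) (fan_word a)).
Proof.
pose J : 'M[K]_2 := mx22 0 1 1 0.
have JJ : J * J = 1.
  by rewrite mulmx22 [RHS](scalar_mx22 1); congr mx22; ring.
move=> ev; suff -> : rotundus_plus q a =
    \tr (J * word_mx (mx22 1 q 0 q) (mx22 1 0 1 q) (fan_word a) * J).
  by rewrite mxtrace_mulC mulmxA [J *m _]JJ mul1mx.
congr (\tr _).
have [m] := ubnP (size a); elim: m a ev => // m IH [|x [|y a]] //= ev sz.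
  by rewrite /Mplus !big_ord0 expr0 scale1r /word_mx big_nil mulr1 JJ.
have -> : Mplus q [:: x, y & a] =
   (mx22 (qint q x) (q ^+ x) 1 0 * (q ^+ y *: mx22 (qint q^-1 y) (q ^- y) 1 0)) * Mplus q a.
  rewrite /Mplus big_mkcond !big_ord_recl [in RHS]big_mkcond /= add0n exprD.
  under eq_bigr do rewrite negbK add0n.
  under [X in _ * (_ * X)]eq_bigr do rewrite negbK add0n.
  by rewrite mulrA -scalerA [q ^+ (\sum_(_ < _) _) *: _]scalerAr scalerAl scalerAr.
rewrite (IH a); [|by rewrite negbK in ev|by lia].
rewrite fan_word_cons2 !word_mx_cat !word_mx_nseq expr_upper22 expr_lower22.
have -> : mx22 (qint q x) (q ^+ x) 1 0 = J * mx22 1 0 (qint q x) (q ^+ x).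
  by rewrite mulmx22; congr mx22; ring.
have -> : q ^+ y *: mx22 (qint q^-1 y) (q ^- y) 1 0 =
          mx22 1 (q * qint q y) 0 (q ^+ y) * J.
  rewrite scalemx22 mulmx22 qint_inv divrr ?unitrX //; congr mx22; ring.
by rewrite !mulrA -[_ * J * J]mulrA JJ mulr1.
Qed.

End Rotundi.

(** * Traces as sums over closed walks *)

Section ClosedWalks.

Local Open Scope ring_scope.

Variable K : comUnitRingType.

Definition mxb (f : bool -> bool -> K) : 'M[K]_2 :=
  mx22 (f true true) (f true false) (f false true) (f false false).

Definition idx (b : bool) : 'I_2 := if b then 0 else 1.

Lemma mulmxb f (M : 'M[K]_2) x j :
  (mxb f * M) (idx x) j = \sum_(z : bool) f x z * M (idx z) j.
Proof.
rewrite big_bool mxE 2!big_ord_recl big_ord0 addr0 !mxE.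
by case: x; congr (_ + _ * M _ _); apply/val_inj.
Qed.

Lemma prod_mxb n (A : nat -> bool -> bool -> K) x y :
  (\prod_(j < n) mxb (A j)) (idx x) (idx y) =
  \sum_(t : n.-tuple bool | last x t == y)
     \prod_(j < n) A j (nth true (x :: t) j) (nth true t j).
Proof.
elim: n A x => [|n IH] A x.
  rewrite big_ord0 mxE; have -> : (idx x == idx y) = (x == y) by case: x y => [] [].
  have [<-|xy] := eqVneq x y; last first.
    by rewrite big_pred0 // => t; rewrite (tuple0 t); apply/negbTE.
  by rewrite (big_pred1 [tuple]) ?big_ord0 // => t; rewrite (tuple0 t) /= !eqxx.
rewrite big_ord_recl mulmxb.
under eq_bigr => z _ do rewrite (IH (fun j => A j.+1)) mulr_sumr.
rewrite pair_big_dep /= (reindex (fun p : bool * n.-tuple bool => cons_tuple p.1 p.2)) /=.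
  by apply: eq_bigr => -[z t] _; rewrite big_ord_recl.
exists (fun t => (thead t, behead_tuple t)) => [[z t]|t] _ /=.
  by congr pair; apply/val_inj.
by rewrite [RHS]tuple_eta; apply/val_inj.
Qed.

(** The trace of a product is a sum over closed walks.  The factor j carries the
    step from the state number j - 1 to the state number j, cyclically. *)
Lemma trace_prod_mxb n (A : 'I_n -> bool -> bool -> K) : (0 < n)%N ->
  \tr (\prod_(j < n) mxb (A j)) =
  \sum_(s : {ffun 'I_n -> bool}) \prod_j A j (s (ord_pred j)) (s j).
Proof.
case: n A => // n A _; pose A' k := A (inord k).
have -> : \prod_(j < n.+1) mxb (A j) = \prod_(j < n.+1) mxb (A' j).
  by apply: eq_bigr => j _; rewrite /A' inord_val.
have -> (M : 'M[K]_2) : \tr M = \sum_(x : bool) M (idx x) (idx x).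
  rewrite /mxtrace big_bool 2!big_ord_recl big_ord0 addr0.
  by congr (_ + M _ _); apply/val_inj.
under eq_bigr => x _ do rewrite prod_mxb.
pose F (t : n.+1.-tuple bool) :=
  \prod_(j < n.+1) A' j (nth true (last true t :: t) j) (nth true t j).
transitivity (\sum_t F t).
  rewrite [RHS](partition_big (fun t : n.+1.-tuple bool => last true t) xpredT) //.
  apply: eq_bigr => x _; apply: eq_big => [t|t]; first by case/tupleP: t.
  by case/tupleP: t => z t /= /eqP <-.
rewrite (reindex (fun s : {ffun 'I_n.+1 -> bool} => [tuple s i | i < n.+1])) /=.
  apply: eq_bigr => s _; apply: eq_bigr => j _; rewrite /A' inord_val.
  have nthE (i : 'I_n.+1) : nth true [tuple s i | i < n.+1] i = s i.
    by rewrite -tnth_nth tnth_mktuple.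
  congr (A j _ _); last exact: nthE.
  have [j0|j_gt0] := posnP j; last first.
    rewrite -nthE -{1}(prednK j_gt0) /=; congr nth.
    case: (j : nat) j_gt0 (ltn_ord j) => // m _ /ltnW lt_m.
    by rewrite addSn /= modnDr modn_small.
  rewrite j0 -nthE; move: (mktuple s) => t.
  by rewrite [LHS](last_nth true) size_tuple /= j0 add0n modn_small.
exists (fun t : n.+1.-tuple bool => [ffun i => tnth t i]) => [s|t] _.
  by apply/ffunP => i; rewrite ffunE tnth_mktuple.
by apply/eq_from_tnth => i; rewrite tnth_mktuple ffunE.
Qed.

End ClosedWalks.

(** * Rotation of cyclic indices *)

Section Rotation.

Variable n : nat.
Implicit Types i j : 'I_n.

Lemma val_iter_ordS m i : val (iter m (@ordS n) i) = (i + m) %% n.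
Proof.
elim: m => [|m IH] /=; first by rewrite addn0 modn_small.
by rewrite IH -addn1 modnDml addn1 addnS.
Qed.

Lemma iter_ordSK m : cancel (iter m (@ordS n)) (iter m (@ord_pred n)).
Proof. by elim: m => // m IH i; rewrite iterSr /= ordSK IH. Qed.

Lemma iter_ord_pred_full i : iter n (@ord_pred n) i = i.
Proof.
rewrite -{1}[i](_ : iter n (@ordS n) i = i) ?iter_ordSK //.
by apply/val_inj; rewrite val_iter_ordS modnDr modn_small.
Qed.

Lemma iter_ord_pred_reach i j : exists2 m, m < n & iter m (@ord_pred n) i = j.
Proof.
exists ((i + (n - j)) %% n); first by rewrite ltn_pmod // (leq_ltn_trans _ (ltn_ord i)).
rewrite -[RHS](iter_ordSK ((i + (n - j)) %% n) j); congr iter; apply/val_inj.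
rewrite val_iter_ordS modnDmr addnC -addnA subnK 1?ltnW //.
by rewrite modnDr modn_small.
Qed.

Lemma uniq_traject_ord_pred i : uniq (traject (@ord_pred n) i n).
Proof.
apply: (@leq_size_uniq _ (enum 'I_n)); rewrite ?enum_uniq //.
  move=> j _; have [m lt_m <-] := iter_ord_pred_reach i j.
  by apply/trajectP; exists m.
by rewrite size_traject size_enum_ord.
Qed.

Lemma mem_traject_ord_pred i j : j \in traject (@ord_pred n) i n.
Proof. by have [m lt_m <-] := iter_ord_pred_reach i j; apply/trajectP; exists m. Qed.

Lemma ord_pred_ind (P : pred 'I_n) i j :
  (forall l, P l -> P (ord_pred l)) -> P i -> P j.
Proof.
by move=> step Pi; have [m _ <-] := iter_ord_pred_reach i j; elim: m => //= m; apply: step.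
Qed.

End Rotation.

(** * Vertices of the glued fan *)

Section FanVertices.

Variables (w : seq bool) (d : nat).
Hypothesis has_up : has id w.
Hypothesis has_down : has negb w.
Hypothesis d_down : ~~ has id (take d w).

Let k := count id w.

Lemma count_take_leq (p : pred bool) e e' :
  e <= e' -> count p (take e w) <= count p (take e' w).
Proof. by move=> /subnK <-; rewrite addnC takeD count_cat leq_addr. Qed.

Lemma count_takeS (p : pred bool) e : e < size w ->
  count p (take e.+1 w) = count p (take e w) + p (nth false w e).
Proof. by move=> lt_e; rewrite (take_nth false) // -cats1 count_cat /= addn0. Qed.

Lemma lt_d_size : d < size w.
Proof.
rewrite ltnNge; apply/negP => le_d; move: d_down.
by rewrite take_oversize // has_up.
Qed.

Lemma count_take_max (p : pred bool) e : count p (take e w) <= count p w.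
Proof. by rewrite -{2}(cat_take_drop e w) count_cat leq_addr. Qed.

Lemma count_up_down : count id w + count negb w = size w.
Proof. exact: (count_predC id). Qed.

Let k_gt0 : 0 < k. Proof. by rewrite -has_count. Qed.
Let l_gt0 : 0 < count negb w. Proof. by rewrite -has_count. Qed.

Lemma val_vertex_top e : val (vertex w true e) = (count id (take e w)).+1.
Proof. by rewrite /= inordK //; have := count_take_max id e; have := count_up_down; lia. Qed.

Lemma val_vertex_bottom e : val (vertex w false e) =
  if count negb (take e w) == 0 then 0 else (size w).+2 - count negb (take e w).
Proof.
rewrite /= inordK ?ltn_pmod //.
case: eqP => [->|ne0]; first by rewrite subn0 modnn.
by rewrite modn_small //; lia.
Qed.

Lemma val_glue b e :
  let v := val (vertex w b e) in
  val (glue d (vertex w b e)) =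
  if v == k.+1 then 1 else if v == val (vertex w false d) then k.+2 else v.
Proof.
have := count_up_down; rewrite -/k => kl.
rewrite /glue -!val_eqE -[val (inord k.+1)]/(nat_of_ord _) inordK; last by lia.
by case: ifP => _; [|case: ifP => _ //]; rewrite [LHS]inordK //; lia.
Qed.

(** These two lemmas compute the labels after gluing: the top vertices are
    1, ..., k, the bottom ones k + 2, ..., n - 1, and the last vertex of each side is
    identified with the first one. *)
Lemma val_glue_top e :
  val (glue d (vertex w true e)) =
  if count id (take e w) == k then 1 else (count id (take e w)).+1.
Proof.
have le_k := count_take_max id e; have le_l := count_take_max negb d.
have := count_up_down; rewrite -/k in le_k * => kl.
rewrite val_glue val_vertex_top val_vertex_bottom eqSS; case: ifP => // _.
by case: ifP => //; case: ifP; lia.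
Qed.

Lemma val_glue_bottom e :
  val (glue d (vertex w false e)) =
  if count negb (take e w) == count negb (take d w) then k.+2
  else if count negb (take e w) == 0 then 0
  else (size w).+2 - count negb (take e w).
Proof.
have le_l := count_take_max negb d; have le_e := count_take_max negb e.
have := count_up_down; rewrite -/k => kl.
rewrite val_glue !val_vertex_bottom.
by do !case: eqP => //; lia.
Qed.

(** The endpoint on side b (top for true) of the right edge of triangle j.
    Triangles number the edges, so that no edge appears twice after gluing. *)
Definition right_end (b : bool) (j : 'I_(size w - d)) : 'I_(size w).+2 :=
  glue d (vertex w b (d + j).+1).

Local Notation V := right_end.

Lemma lt_pos (j : 'I_(size w - d)) : d + j < size w.
Proof. by rewrite -ltn_subRL. Qed.

Lemma glue_wrap b : glue d (vertex w b (size w)) = glue d (vertex w b d).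
Proof.
have up0 : count id (take d w) = 0 by apply/eqP; rewrite -leqn0 leqNgt -has_count.
apply/val_inj; case: b.
  by rewrite !val_glue_top take_size up0 eqxx; case: eqP => // k0; lia.
have := count_up_down; rewrite -/k => kl.
rewrite !val_glue_bottom take_size eqxx; do !case: eqP => //; lia.
Qed.

(** The edge on the left of the first triangle is glued to the right edge of the last
    one, so that the left end of any triangle is a right end of its predecessor. *)
Lemma right_end_pred b j : V b (ord_pred j) = glue d (vertex w b (d + j)).
Proof.
have lt_d := lt_d_size; rewrite /right_end /=.
have [->|j_gt0] := posnP j.
  rewrite addn0 -glue_wrap add0n modn_small; last by lia.
  by congr (glue _ (vertex _ _ _)); lia.
have lt_j := ltn_ord j.
rewrite -(prednK j_gt0) addSn /= modnDr modn_small; last by lia.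
by rewrite addnS.
Qed.

(** The apex of a triangle is an end of both of its edges. *)
Lemma right_end_stay b j : base_up j != b -> V b (ord_pred j) = V b j.
Proof.
move=> up_j; rewrite right_end_pred /right_end; congr glue.
have takeS p := count_takeS p (lt_pos j).
by case: b up_j; rewrite /base_up => up_j; rewrite /vertex takeS;
  case: nth up_j => //; rewrite addn0.
Qed.

Lemma right_end_sep i j : V true i != V false j.
Proof.
have := count_up_down; rewrite -/k => kl.
have le_j := count_take_max negb (d + j).+1.
have le_dj : count negb (take d w) <= count negb (take (d + j).+1 w).
  by apply: count_take_leq; lia.
rewrite -val_eqE val_glue_top val_glue_bottom.
by have := count_take_max id (d + i).+1; rewrite -/k; do !case: eqP => //; lia.
Qed.

Lemma right_end_color b b' i j : V b i = V b' j -> b = b'.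
Proof.
have := (right_end_sep i j, right_end_sep j i).
by case: b; case: b' => // sep eV; move: sep; rewrite eV eqxx => -[].
Qed.

(** Bases on the same circle are told apart by their rank on this circle, which grows
    strictly with the triangle; gluing only identifies the vertex after the last
    base with the one before the first base. *)
Lemma right_end_inj i j : V (base_up i) i = V (base_up j) j -> i = j.
Proof.
move=> eqV; have ij := right_end_color eqV; move: eqV.
wlog lt_ij : i j ij / i < j.
  have [lt_ij|lt_ji|/val_inj] := ltngtP i j; [exact|move=> H /esym /H ->|] => //.
have mono (p : pred bool) e (l : 'I_(size w - d)) : p (base_up l) -> e <= d + l ->
    count p (take e w) < count p (take (d + l).+1 w).
  move=> pl le_e; rewrite (count_takeS _ (lt_pos l)) -/(base_up l) pl addn1 ltnS.
  exact: count_take_leq.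
have := count_up_down; rewrite -/k => kl.
have le_j (p : pred bool) := count_take_max p (d + j).+1.
rewrite /right_end => /(congr1 val).
have lt_dij : (d + i).+1 <= d + j by rewrite ltn_add2l.
case Ej: (base_up j) ij => Ei.
  have := mono id _ j; rewrite Ej => /(_ _ isT lt_dij).
  have := mono id _ i; rewrite Ei => /(_ _ isT (leq_addr _ _)).
  have := le_j id; rewrite !val_glue_top -/k.
  by do !case: eqP; lia.
have := mono negb _ j; rewrite Ej => /(_ _ isT lt_dij).
have := mono negb _ i; rewrite Ei => /(_ _ isT (leq_addr _ _)).
have := le_j negb; rewrite !val_glue_bottom.
by do !case: eqP; lia.
Qed.

Lemma boundary_pointsE b : fan_boundary_points w d b = [set V b j | j : 'I_(size w - d)].
Proof.
have lt_d := lt_d_size.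
apply/setP => v; apply/imsetP/imsetP => [] [j].
  rewrite inE leq_eqVlt => /orP[/eqP dj ->|lt_dj ->].
    have lt_m : (size w - d).-1 < size w - d by lia.
    exists (Ordinal lt_m) => //; rewrite -[val j]/(nat_of_ord j) -dj /right_end /= -glue_wrap.
    by congr (glue _ (vertex _ _ _)); lia.
  have lt_m : (j - d).-1 < size w - d by have := ltn_ord j; lia.
  by exists (Ordinal lt_m) => //; rewrite /right_end /=; congr (glue _ (vertex _ _ _)); lia.
move=> _ ->; have lt_j : (d + j).+1 < (size w).+1 by rewrite ltnS lt_pos.
by exists (Ordinal lt_j) => //; rewrite inE /=; lia.
Qed.

End FanVertices.

(** * Closed loops as lists of arcs *)

Section ClosedLoops.

Variable T : triangulation.

Definition follows : rel (Defs.arc T) := [rel e f | target e == source f].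

(** A list of arcs with distinct sources is at most as long as the number of arcs, so
    that tuples of bounded length may be replaced by lists. *)
Lemma closed_loopP (g : loop T) :
  reflect ((exists2 s, [/\ s != [::], cycle follows s & uniq [seq source e | e <- s]]
              & g = ([set x in [seq source e | e <- s]], [set e in s]))
           \/ outer_arcs T = set0 /\ g = (outer_points T, set0))
    (closed_loop g).
Proof.
have setE (s : seq (Defs.arc T)) :
    [set x in [seq source e | e <- s]] = [set source e | e in s].
  by apply/setP => x; rewrite inE; apply/mapP/imsetP => [] [e es ->]; exists e.
apply: (iffP orP) => [[]|].
- case/existsP=> l /existsP[s /and4P[l0 cyc un /eqP gE]].
  left; exists (val s); last by rewrite setE.
  by split=> //; rewrite -size_eq0 size_tuple -lt0n.
- by case/andP=> /eqP A0 /eqP gE; right.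
case=> [[s [s0 cyc un] gE]|[-> ->]]; last by right; rewrite !eqxx.
left; have lt_s : size s < #|Defs.arc T|.+1.
  by rewrite ltnS -(card_uniqP (map_uniq un)) max_card.
apply/existsP; exists (Ordinal lt_s); apply/existsP; exists (in_tuple s).
by rewrite /= lt0n size_eq0 s0 [cycle _ _]cyc un gE setE /=.
Qed.

End ClosedLoops.

(** * Walks around the annulus *)

Section Walks.

Variables (n : nat) (up c : 'I_n -> bool).

(** A state (j, b) is the end b of edge j.  If b is not the apex of the triangle j, the
    choice c j is made there; otherwise the walk stays. *)
Definition walk (x : 'I_n * bool) : 'I_n * bool :=
  (ord_pred x.1, if x.2 == up x.1 then c x.1 else x.2).

Lemma fst_iter_walk m x : (iter m walk x).1 = iter m (@ord_pred n) x.1.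
Proof. by elim: m => //= m ->. Qed.

(** At a triangle j, ends are either kept (c j = up j) or both sent to ~~ up j; maps
    of these two kinds are closed under composition. *)
Lemma iter_walk_fibre m i :
  (forall b, (iter m walk (i, b)).2 = b) \/
  (exists c0, forall b, (iter m walk (i, b)).2 = c0).
Proof.
elim: m => [|m IH]; first by left.
have [cE|cN] := eqVneq (c (iter m (@ord_pred n) i)) (up (iter m (@ord_pred n) i)).
  have keep b : (iter m.+1 walk (i, b)).2 = (iter m walk (i, b)).2.
    by rewrite /= fst_iter_walk cE; case: eqP.
  by case: IH => [idF|[c0 F]]; [left|right; exists c0] => b; rewrite keep.
right; exists (~~ up (iter m (@ord_pred n) i)) => b; rewrite /= fst_iter_walk.
by case: eqP => [_|]; move: cN; case: (c _); case: (up _) => // _; case: (_.2).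
Qed.

(** A full turn maps each fibre to itself by the identity or by a constant map; in
    both cases it fixes the states that are periodic. *)
Lemma iter_walk_full m x : iter m.+1 walk x = x -> iter n walk x = x.
Proof.
move=> xm; case: x xm => i b xm.
have fst_n : (iter n walk (i, b)).1 = i by rewrite fst_iter_walk iter_ord_pred_full.
suff snd_n : (iter n walk (i, b)).2 = b.
  by rewrite [LHS]surjective_pairing fst_n snd_n.
have [//|[c0 F]] := iter_walk_fibre n i.
have per : iter n walk (iter (m * n) walk (i, b)) = (i, b).
  by rewrite -iterD -mulSn mulnC iterM iter_fix.
have [j [b' [jE]]] : exists j b', j = i /\ iter (m * n) walk (i, b) = (j, b').
  exists i, (iter (m * n) walk (i, b)).2; split=> //.
  rewrite [LHS]surjective_pairing; congr pair.
  by rewrite fst_iter_walk iterM iter_fix // iter_ord_pred_full.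
move=> xE; move: per; rewrite xE jE => /(congr1 snd) /=; rewrite !F; exact.
Qed.

(** A periodic walk closes up after one turn, hence meets each edge in one end. *)
Lemma walk_section m x : iter m.+1 walk x = x ->
  exists s : {ffun 'I_n -> bool},
    forall l, iter l walk x = (iter l (@ord_pred n) x.1, s (iter l (@ord_pred n) x.1)).
Proof.
move/iter_walk_full => per.
exists [ffun j => (iter (index j (traject (@ord_pred n) x.1 n)) walk x).2] => l.
rewrite [LHS]surjective_pairing fst_iter_walk ffunE; congr (_, _.2).
have n0 : 0 < n by rewrite (leq_ltn_trans _ (ltn_ord x.1)).
have red (A : Type) (f : A -> A) y : iter n f y = y -> iter l f y = iter (l %% n) f y.
  by move=> fy; rewrite {1}(divn_eq l n) addnC iterD iterM (iter_fix (l %/ n) fy).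
rewrite (red _ walk) // (red _ (@ord_pred n)) ?iter_ord_pred_full //.
rewrite -(nth_traject (@ord_pred n) (ltn_pmod l n0) x.1) index_uniq ?size_traject ?ltn_pmod //.
exact: uniq_traject_ord_pred.
Qed.

End Walks.

(** * Closed loops of the glued fan *)

Section FanLoops.

Variables (w : seq bool) (d : nat).
Hypothesis has_up : has id w.
Hypothesis has_down : has negb w.
Hypothesis d_down : ~~ has id (take d w).

Local Notation T := (glued_fan w d).
Local Notation I := 'I_(size w - d).
Local Notation V := (right_end (w := w) (d := d)).
Local Notation pr := (@ord_pred (size w - d)).
Implicit Types (t u : I) (b : bool) (e f : Defs.arc T).

(** An arc is determined by the triangle t whose base has its source as right end, and
    by the side b (the exit) on which it reaches the left edge of t: the base stays
    on its side, the right edge of t leads to the apex. *)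
Definition out_arc b t : Defs.arc T := if b == base_up t then inr t else inl t.
Definition start_triangle e : I := match e with inl t => t | inr t => t end.
Definition exit e : bool :=
  match e with inl t => ~~ base_up t | inr t => base_up t end.

Lemma out_arcK e : out_arc (exit e) (start_triangle e) = e.
Proof. by case: e => t; rewrite /out_arc /= ?eqxx //; case: base_up. Qed.

Lemma start_triangle_out_arc b t : start_triangle (out_arc b t) = t.
Proof. by rewrite /out_arc; case: ifP. Qed.

Lemma exit_out_arc b t : exit (out_arc b t) = b.
Proof. by rewrite /out_arc; case: eqP => //=; case: b; case: base_up. Qed.

Lemma source_fan e : source e = V (base_up (start_triangle e)) (start_triangle e).
Proof. by case: e. Qed.

(** The apex may be taken on the left edge as well as on the right one, so that both
    arcs out of t end on the left edge of t. *)
Lemma target_fan e : target e = V (exit e) (pr (start_triangle e)).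
Proof.
case: e => t /=; last by rewrite right_end_pred.
by rewrite right_end_stay //; case: base_up.
Qed.

Lemma base_up_ex : exists t : I, base_up t.
Proof.
have : has id (drop d w).
  by move: has_up; rewrite -{1}(cat_take_drop d w) has_cat (negbTE d_down).
move=> /(has_nthP false)[i lt_i up_i]; rewrite size_drop in lt_i.
by exists (Ordinal lt_i); rewrite /base_up -nth_drop.
Qed.

(** An end of the right edge of t is the apex of t when it is not on the side of the
    base, [base_up t]. *)
Definition passage (s : I -> bool) : bool :=
  [forall t, (s t != base_up t) ==> (s (pr t) == s t)].

Lemma passageP (s : I -> bool) :
  reflect (forall t, s t != base_up t -> s (pr t) = s t) (passage s).
Proof.
apply: (iffP forallP) => H t; last by apply/implyP => /H ->.
by move=> st; apply/eqP; apply: (implyP (H t)).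
Qed.

(** Arcs are used at the triangles where s arrives at the right end of the base. *)
Definition passage_loop (s : I -> bool) : loop T :=
  ([set V (s t) t | t : I],
   [set e | (s (start_triangle e) == base_up (start_triangle e))
            && (exit e == s (pr (start_triangle e)))]).

Lemma V_pass s t : passage s -> s t != base_up t -> V (s (pr t)) (pr t) = V (s t) t.
Proof. by move=> /passageP sP st; rewrite (sP _ st) right_end_stay // eq_sym. Qed.

(** Reading s leftward during one turn and keeping the arcs at the triangles whose
    base is reached gives the cycle. *)
Lemma closed_passage_loop s : passage s -> closed_loop (passage_loop s).
Proof.
move=> sP; have /passageP sP' := sP; apply/closed_loopP.
have [t0 /eqP t0_hit|no_hit] := pickP (fun t => s t == base_up t); last first.
  (* If s never reaches a base, it is constant and all bases are on the other side;
     as some base is up, s is the bottom circle, which bears no arc. *)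
  right; have missE t : s t = ~~ base_up t.
    by move: (no_hit t); case: (s t); case: base_up.
  have [t1 up1] := base_up_ex.
  have s0 t : s t = false.
    apply/eqP; apply: (@ord_pred_ind _ (fun u => s u == false) t1) => [u|].
      by rewrite sP' // no_hit.
    by rewrite missE up1.
  split.
    apply/setP => e; rewrite inE; apply/imsetP => -[t].
    by rewrite inE => up_t; have := missE t; rewrite s0 (eqP up_t).
  congr pair; last by apply/setP => e; rewrite !inE no_hit.
  rewrite [RHS]boundary_pointsE //.
  by apply: eq_imset => t; rewrite s0.
left.
have [n nL] : exists n, size w - d = n.+1.
  by exists (size w - d).-1; rewrite prednK // (leq_ltn_trans _ (ltn_ord t0)).
pose hits ts := [seq out_arc (s (pr t)) t | t <- ts & s t == base_up t].
have hits_cons t ts : hits (t :: ts) =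
    if s t == base_up t then out_arc (s (pr t)) t :: hits ts else hits ts.
  by rewrite /hits /=; case: ifP.
(* Where no arc is used, s stays at the same vertex, hence the target of the last
   arc is the vertex reached by s after m triangles. *)
have hits_path m t e : target e = V (s t) t ->
    path (@follows T) e (hits (traject pr t m)) /\
    target (last e (hits (traject pr t m))) = V (s (iter m pr t)) (iter m pr t).
  elim: m t e => [|m IH] t e et; first by split.
  rewrite iterSr trajectS hits_cons; case: eqP => [hit_t|/eqP miss_t].
    have [|IHp ->] := IH (pr t) (out_arc (s (pr t)) t).
      by rewrite target_fan exit_out_arc start_triangle_out_arc.
    split=> //; apply/andP; split=> //.
    by apply/eqP; rewrite et source_fan start_triangle_out_arc hit_t.
  by apply: IH; rewrite V_pass.
have mem_hits e : (e \in hits (traject pr t0 n.+1)) =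
    (s (start_triangle e) == base_up (start_triangle e))
    && (exit e == s (pr (start_triangle e))).
  apply/mapP/andP => [[t]|[hit_e /eqP exit_e]].
    rewrite mem_filter => /andP[hit_t _] ->.
    by rewrite exit_out_arc start_triangle_out_arc.
  exists (start_triangle e); last by rewrite -exit_e out_arcK.
  by rewrite mem_filter hit_e -nL mem_traject_ord_pred.
exists (hits (traject pr t0 n.+1)).
  split.
  - by rewrite hits_cons t0_hit eqxx.
  - rewrite hits_cons t0_hit eqxx /= rcons_path.
    have [|hits_p tgt] := hits_path n (pr t0) (out_arc (s (pr t0)) t0).
      by rewrite target_fan exit_out_arc start_triangle_out_arc.
    apply/andP; split=> //; apply/eqP; rewrite tgt -iterSr -nL iter_ord_pred_full.
    by rewrite source_fan start_triangle_out_arc t0_hit.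
  - rewrite -map_comp map_inj_in_uniq.
      by rewrite filter_uniq // -nL uniq_traject_ord_pred.
    move=> t u _ _; rewrite -![(_ \o _) _]/(source (out_arc _ _)).
    rewrite !source_fan !start_triangle_out_arc.
    exact: right_end_inj.
congr pair; last by apply/setP => e; rewrite !inE mem_hits.
apply/setP => v; rewrite inE; apply/imsetP/mapP => [[t _ ->]|[e]]; last first.
  rewrite mem_hits => /andP[/eqP hit_e _] ->.
  by exists (start_triangle e); rewrite // source_fan hit_e.
(* Every vertex of the passage is the source of the next arc on its left. *)
have [m _ ] := iter_ord_pred_reach t t0.
elim: m t => [|m IH] t.
  move=> t_t0; rewrite (t_t0 : t = t0).
  exists (out_arc (s (pr t0)) t0); last by rewrite source_fan start_triangle_out_arc t0_hit.
  by rewrite mem_hits start_triangle_out_arc exit_out_arc t0_hit !eqxx.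
rewrite iterSr => /IH [e e_hit Ve].
have [hit_t|miss_t] := eqVneq (s t) (base_up t).
  exists (out_arc (s (pr t)) t); last by rewrite source_fan start_triangle_out_arc hit_t.
  by rewrite mem_hits start_triangle_out_arc exit_out_arc hit_t !eqxx.
by exists e; rewrite // -Ve V_pass.
Qed.

(** The arcs of the loop tell at which triangles s meets the base, and s differs from
    the side of the base at the others. *)
Lemma passage_loop_inj (s s' : I -> bool) : passage_loop s = passage_loop s' -> s =1 s'.
Proof.
move/(congr1 snd)/setP => arcsE t.
suff hitE : (s t == base_up t) = (s' t == base_up t).
  by move: hitE; case: (s t); case: (s' t); case: base_up.
have := (arcsE (out_arc (s (pr t)) t), arcsE (out_arc (s' (pr t)) t)).
rewrite !inE !start_triangle_out_arc !exit_out_arc !eqxx !andbT => -[e1 e2].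
by move: e1 e2; do 2 case: (_ == base_up t) => //=; case: eqP.
Qed.

Lemma uniq_map_inj_in (A B : eqType) (f : A -> B) (l : seq A) :
  uniq (map f l) -> {in l &, injective f}.
Proof.
elim: l => //= x l IH /andP[x_l uniq_l] a b; rewrite !inE.
move=> /predU1P[->|a_l] /predU1P[->|b_l] // fab; last exact: IH.
  by rewrite fab map_f in x_l.
by rewrite -fab map_f in x_l.
Qed.

Section Winding.

Variable sq : seq (Defs.arc T).
Hypothesis sq_cycle : cycle (@follows T) sq.
Hypothesis sq_uniq : uniq [seq source e | e <- sq].

(** The choices made by the cycle at the triangles whose base it meets; arbitrary
    elsewhere. *)
Let dir t := if inr t \in sq then base_up t else ~~ base_up t.

Local Notation step := (walk (@base_up w d) dir).

Let start e := (start_triangle e, base_up (start_triangle e)).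

Lemma start_triangle_inj_in e f : e \in sq -> f \in sq ->
  start_triangle e = start_triangle f -> e = f.
Proof.
move=> e_sq f_sq tri_ef; apply: (uniq_map_inj_in sq_uniq) => //.
by rewrite !source_fan tri_ef.
Qed.

(** The two arcs out of t have the same source, so that a simple cycle contains at
    most one of them. *)
Lemma exit_dir e : e \in sq -> exit e = dir (start_triangle e).
Proof.
rewrite /dir; case: e => t e_sq; case: ifP => // in_sq.
  by have := start_triangle_inj_in e_sq in_sq erefl.
by rewrite [X in X = false]e_sq in in_sq.
Qed.

(** Between two choices the walk stays at one vertex, so that it goes through all
    the edges on the left until the one where this vertex ends a base. *)
Lemma walk_to_vertex b t u : V b t = V (base_up u) u ->
  exists m, iter m step (t, b) = (u, base_up u).
Proof.
move=> Vtu; have eq_b : b = base_up u by exact: right_end_color Vtu.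
have [m _] := iter_ord_pred_reach t u.
elim: m t Vtu => [|m IH] t Vtu; first by move=> /= ->; exists 0; rewrite -eq_b.
rewrite iterSr => /IH IHt; have [b_t|b_t] := eqVneq b (base_up t).
  by exists 0; rewrite -eq_b; congr pair; apply: right_end_inj => //; rewrite -b_t.
have [|m' <-] := IHt; first by rewrite right_end_stay // eq_sym.
by exists m'.+1; rewrite iterSr /walk /= (negbTE b_t).
Qed.

Lemma walk_step e f : e \in sq -> follows e f ->
  exists m, iter m.+1 step (start e) = start f.
Proof.
move=> e_sq /eqP; rewrite target_fan source_fan => /walk_to_vertex [m walk_f].
by exists m; rewrite [RHS]/start -walk_f iterSr /walk /= eqxx exit_dir.
Qed.

Lemma walk_path e p : path (@follows T) e p -> {subset e :: p <= sq} ->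
  {in p, forall f, exists m, iter m.+1 step (start e) = start f}.
Proof.
elim: p e => [//|e' p IH] e /= /andP[ee' pathp] sub f.
have [m me'] := walk_step (sub _ (mem_head _ _)) ee'.
rewrite inE => /predU1P[->|f_p]; first by exists m.
have [|m' walk_f'] := IH e' pathp _ f f_p.
  by move=> x x_p; apply: sub; rewrite inE x_p orbT.
by exists (m' + m.+1); rewrite -[RHS]walk_f' -me' -iterD.
Qed.

(** The walk never leaves the vertices of the cycle: the arc that it chooses at one of
    them belongs to the cycle, and leads to the source of the next arc. *)
Lemma walk_visits e m : e \in sq ->
  V (iter m step (start e)).2 (iter m step (start e)).1 \in [seq source f | f <- sq].
Proof.
move=> e_sq; elim: m => [|m IH]; first by rewrite -source_fan map_f.
rewrite iterS; case: (iter m step (start e)) IH => t b IH.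
suff : V (if b == base_up t then dir t else b) (pr t) \in [seq source f | f <- sq] by [].
have {IH} : V b t \in [seq source f | f <- sq] := IH.
have [->|b_t] := eqVneq b (base_up t); last by rewrite right_end_stay // eq_sym.
case/mapP=> f f_sq; rewrite source_fan => /right_end_inj -> //.
rewrite -exit_dir // -target_fan; apply/mapP; exists (next sq f); first by rewrite mem_next.
by apply/eqP; apply: (next_cycle sq_cycle f_sq).
Qed.

(** The walk that starts with an arc of the cycle visits all its arcs and comes back,
    hence closes up after one turn; the ends it meets are the passage. *)
Lemma cycle_passage : sq != [::] -> exists2 s : {ffun I -> bool}, passage s &
  ([set x in [seq source e | e <- sq]], [set e in sq]) = passage_loop s.
Proof.
move=> sq0; have [a [p sqE]] : exists a p, sq = a :: p.
  by case: sq sq0 => // a p _; exists a, p.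
have a_sq : a \in sq by rewrite sqE mem_head.
have reach f : f \in sq -> exists m, iter m.+1 step (start a) = start f.
  move=> f_sq; apply: (@walk_path a (rcons p a)).
  - by move: sq_cycle; rewrite sqE.
  - by move=> x; rewrite inE mem_rcons sqE inE orbA orbb.
  - by rewrite mem_rcons -sqE.
have [m am] := reach a a_sq.
have [s sE] := walk_section am.
have s_at l : iter l step (start a) =
    (iter l pr (start_triangle a), s (iter l pr (start_triangle a))) by exact: sE.
have s_pr t : s (pr t) = if s t == base_up t then dir t else s t.
  have [l _ <-] := iter_ord_pred_reach (start_triangle a) t.
  by have := s_at l.+1; rewrite !iterS s_at => -[].
have visit t : V (s t) t \in [seq source f | f <- sq].
  have [l _ <-] := iter_ord_pred_reach (start_triangle a) t.
  by have := walk_visits l a_sq; rewrite s_at.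
have hit e : e \in sq -> s (start_triangle e) = base_up (start_triangle e).
  by move=> /reach [l]; rewrite s_at => -[-> ->].
have passage_s : passage s by apply/passageP => t /negbTE s_t; rewrite s_pr s_t.
exists s => //; congr pair; apply/setP.
  move=> v; rewrite inE; apply/mapP/imsetP => [[e e_sq ->]|[t _ ->]].
    by exists (start_triangle e) => //; rewrite source_fan hit.
  exact/mapP.
move=> e; rewrite !inE; apply/idP/andP => [e_sq|[/eqP hit_e /eqP exit_e]].
  by rewrite hit // eqxx s_pr hit // eqxx exit_dir.
have /mapP[f f_sq] := visit (start_triangle e).
rewrite hit_e source_fan => /right_end_inj ef.
have {}ef : start_triangle e = start_triangle f by exact: ef.
(* The cycle leaves this vertex by f, and e = f since both follow the choice [dir]. *)
rewrite -(out_arcK e) exit_e ef s_pr hit // eqxx -exit_dir // out_arcK; exact: f_sq.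
Qed.

End Winding.

Lemma closed_loop_passage (g : loop T) : closed_loop g ->
  exists2 s : {ffun I -> bool}, passage s & g = passage_loop s.
Proof.
case/closed_loopP => [[sq [sq0 sq_cycle sq_uniq] ->]|[outer0 ->]].
  exact: cycle_passage.
have all_up t : base_up t.
  case up_t: (base_up t) => //.
  have : inr t \in outer_arcs T by apply/imsetP; exists t => //; rewrite inE up_t.
  by rewrite outer0 inE.
exists [ffun => false]; first by apply/passageP => t; rewrite !ffunE.
congr pair; last by apply/setP => e; rewrite !inE ffunE all_up.
rewrite [LHS]boundary_pointsE //.
by apply: eq_imset => t; rewrite ffunE.
Qed.

End FanLoops.

(** * Enclosed triangles and the generating function *)

Section FanSums.

Variables (w : seq bool) (d : nat).
Hypothesis has_up : has id w.
Hypothesis has_down : has negb w.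
Hypothesis d_down : ~~ has id (take d w).

Local Notation T := (glued_fan w d).
Local Notation I := 'I_(size w - d).
Local Notation V := (right_end (w := w) (d := d)).
Local Notation pr := (@ord_pred (size w - d)).
Implicit Types (t u : I) (b : bool) (e f : Defs.arc T).

(** Both boundary circles at once: the inner one for b = true, the outer one for
    b = false, so that ar and coar are instances of one count. *)
Definition enclosed_on b (g : loop T) : {set triangle T} :=
  @enclosed T (fan_boundary_points w d b) (fan_boundary_arcs w d b) g.

(** The apex of a triangle is on both of its edges, so that all its corners are ends of
    its left or of its right edge. *)
Lemma corner_fan (t : triangle T) (v : point T) : v \in corners t ->
  exists b, v = V b t \/ v = V b (pr t).
Proof.
have side_cases e : e \in sides t ->
    start_triangle e = pr t /\ (e = inl (pr t)) \/ start_triangle e = t.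
  by rewrite !inE => /orP[/orP[]|] /eqP ->; [left|right|right].
rewrite inE => /orP[] /imsetP[e /side_cases e_t ->].
  rewrite source_fan; exists (base_up (start_triangle e)).
  by case: e_t => [[-> _]|->]; [right|left].
rewrite target_fan //; exists (exit e).
case: e_t => [[-> ->]|->]; last by right.
by right; rewrite right_end_stay //=; case: base_up.
Qed.

Section OnePassage.

Variable s : I -> bool.
Hypothesis sP : passage s.
Local Notation g := (passage_loop s).

(** Neighbours are t - 1 and t, and their common side, the right edge of t - 1, is on
    the loop exactly when s changes there. *)
Lemma off_loop_side t u : off_loop g t u -> s (pr t) = s (pr u).
Proof.
have cut x : (inl x : Defs.arc T) \notin g.2 -> s (pr x) = s x.
  rewrite !inE /=; have [hit_x|miss_x] := eqVneq (s x) (base_up x).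
    by rewrite -hit_x; case: (s x); case: (s (pr x)).
  by move/passageP: sP => ->.
case/subsetPn => x; rewrite inE => /andP[xt xu] x_off; rewrite !inE in xt xu.
have inlE y z : ((inl y : fan_arc w d) == inl z) = (y == z) by [].
have inrE y z : ((inr y : fan_arc w d) == inr z) = (y == z) by [].
case: x xt xu x_off => x; last by rewrite !inrE /= => /eqP <- /eqP <-.
rewrite !inlE !orbF.
by move=> /orP[] /eqP xt /orP[] /eqP xu /cut s_x; rewrite -xt -xu.
Qed.

(** A triangle t with s (t - 1) <> b is connected rightward, along edges where s does
    not change, to the next triangle with its base on side b, and this base is not
    on the loop.  If no base is on side b, this circle has a single point and no
    arc, and the loop is the opposite circle, which avoids this point.
    Conversely a triangle that touches the circle b off the loop has
    s (t - 1) <> b, and so has any triangle connected to it. *)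
Lemma enclosed_passage b :
  enclosed_on b (passage_loop s) = [set t | s (pr t) != b].
Proof.
have /passageP s_step := sP.
apply/setP => t; rewrite !inE; apply/existsP/idP.
  case=> u /andP[/closed_connect tu wit].
  have := tu [pred t | s (pr t) != b].
  rewrite !inE => -> => [|x y /off_loop_side xy]; last by rewrite !inE xy.
  case/orP: wit => /subsetPn[x]; rewrite inE.
    case/andP=> /corner_fan[b' x_b']; rewrite boundary_pointsE // => /imsetP[j _ xj].
    have eb : b' = b by case: x_b'; rewrite xj => eqV; apply/esym; apply: right_end_color eqV.
    rewrite {}eb {b'} in x_b'; have pass : x = V b (pr u) -> x \notin g.1 -> s (pr u) != b.
      by move=> ->; apply: contra => /eqP <-; apply/imsetP; exists (pr u).
    case: x_b' => [xu|]; last exact: pass.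
    have [up_u|up_u] := eqVneq (base_up u) b; last first.
      by apply: pass; rewrite xu right_end_stay.
    move=> x_off; have s_u : s u != b.
      by apply: contra x_off => /eqP s_u; apply/imsetP; exists u; rewrite // s_u.
    by rewrite s_step // up_u.
  case/andP=> xu /imsetP[y]; rewrite inE => /eqP up_y xy; rewrite xy in xu *.
  move: xu; rewrite !inE /= => /eqP[yu]; rewrite -yu => x_off.
  apply: contra x_off => /eqP s_y; rewrite s_y up_y eqxx andbT.
  rewrite -s_y; apply/eqP.
  by have [//|/s_step ->//] := eqVneq (s y) (base_up y); rewrite s_y up_y.
move=> s_t.
have self (x : triangle T) : base_up x = b -> s (pr x) != b ->
   ~~ (sides x :&: fan_boundary_arcs w d b \subset g.2).
  move=> up_x s_x; apply/subsetPn; exists (inr x); rewrite !inE ?eqxx ?orbT /=.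
    by apply/imsetP; exists x; rewrite ?inE ?up_x.
  by rewrite up_x [b == _]eq_sym (negbTE s_x) andbF.
have [u /eqP up_u|no_u] := pickP (fun u => base_up u == b).
  have [m _] := iter_ord_pred_reach u t.
  elim: m t s_t => [|m IH] t s_t /=.
    by move=> ut; exists t; rewrite connect0 self ?orbT // -ut.
  set t' := iter m pr u => t't.
  have [up_t|up_t] := eqVneq (base_up t) b.
    by exists t; rewrite connect0 self ?orbT.
  have s_t' : s t != b.
    apply: contra s_t => /eqP s_t; rewrite s_step s_t ?eqxx //.
    by rewrite eq_sym.
  have [|u' /andP[t'u' wit]] := IH t' _ erefl; first by rewrite t't.
  exists u'; rewrite wit andbT; apply: connect_trans t'u'; apply: connect1.
  apply/subsetPn; exists (inl t); first by rewrite !inE -t't !eqxx ?orbT.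
  rewrite !inE /=; move: s_t s_t'.
  by case: (s t); case: (s (pr t)); case: b {IH self up_u up_t wit}; case: base_up.
exists t; rewrite connect0 /=; apply/orP; left; apply/subsetPn; exists (V b (pr t)).
  rewrite inE boundary_pointsE // imset_f // andbT inE; apply/orP; right.
  apply/imsetP; exists (inl t); first by rewrite !inE eqxx ?orbT.
  rewrite target_fan //=; congr (V _ _).
  by have := no_u t; case: base_up; case: b {self s_t no_u}.
apply: contra s_t => /imsetP[j _ eqV].
have s_j : b = s j by apply: right_end_color eqV.
apply: (@ord_pred_ind _ (fun u => s u == b) j); last by rewrite s_j.
by move=> x /eqP s_x; rewrite s_step s_x // eq_sym no_u.
Qed.

End OnePassage.

Local Open Scope ring_scope.

Variables (K : comUnitRingType) (q : K).

(** The state goes from x to y when t is read from left to right, so that x is the end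
    reached after crossing t and decides on which side of the loop t lies. *)
Definition cross_weight b c x y : K :=
  if (y == c) || (x == y) then q ^+ (x != b) else 0.

(** Functions s that are not passages have weight zero. *)
Lemma loop_sum_trace b :
  \sum_(g : loop T | closed_loop g)
    q ^+ #|enclosed_on b g|
  = \tr (word_mx (mxb (cross_weight b true)) (mxb (cross_weight b false)) (drop d w)).
Proof.
have n_gt0 : (0 < size w - d)%N by rewrite subn_gt0; exact: lt_d_size.
have -> : word_mx (mxb (cross_weight b true)) (mxb (cross_weight b false)) (drop d w)
        = \prod_(t < size w - d) mxb (cross_weight b (base_up t)).
  rewrite /word_mx (big_nth false) size_drop big_mkord.
  by apply: eq_bigr => t _; rewrite nth_drop -/(base_up t); case: base_up.
rewrite trace_prod_mxb // [RHS](bigID (fun s : {ffun I -> bool} => passage s)) /=.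
rewrite [X in _ + X]big1 ?addr0; last first.
  move=> s; rewrite /passage => /forallPn[t]; rewrite negb_imply => /andP[miss_t turn_t].
  by rewrite (bigD1 t) //= /cross_weight (negbTE miss_t) (negbTE turn_t) mul0r.
rewrite (eq_bigl (mem ((fun s : {ffun I -> bool} => passage_loop s) @:
                       [set s : {ffun I -> bool} | passage s]))).
  rewrite big_imset /=; last by move=> s s' _ _ /passage_loop_inj /ffunP.
  apply: eq_big => [s|s]; rewrite inE // => sP.
  rewrite enclosed_passage // -sum1dep_card big_mkcond /=.
  rewrite -prodrXr /=; apply: eq_bigr => t _; rewrite /cross_weight.
  have -> : (s t == base_up t) || (s (pr t) == s t).
    by have [//|miss_t] := eqVneq (s t); rewrite (elimT (passageP _) sP) ?eqxx.
  by case: ifP.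
move=> g; apply/idP/imsetP => [/closed_loop_passage[] // s sP ->|[s]].
  by exists s; rewrite ?inE.
by rewrite inE => sP ->; apply: closed_passage_loop.
Qed.

(** The transfer matrices have the same five invariants as X and Y, for both
    circles. *)
Lemma loop_sum_word b X Y :
    \tr X = 1 + q -> \tr Y = 1 + q -> \det X = q -> \det Y = q ->
    \tr (X * Y) = 1 + q + q ^+ 2 ->
  \sum_(g : loop T | closed_loop g)
    q ^+ #|enclosed_on b g|
  = \tr (word_mx X Y (drop d w)).
Proof.
move=> trX trY detX detY trXY; rewrite loop_sum_trace.
apply: trace_word; rewrite ?(trX, trY, detX, detY, trXY) /mxb /cross_weight;
  rewrite ?mx22E; case: b; rewrite /= ?expr0 ?expr1; ring.
Qed.

End FanSums.

Section Annuli.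

Local Open Scope ring_scope.

Variables (K : comUnitRingType) (q : K).

Lemma rotundus_plus_loops a b : q \is a GRing.unit ->
    a != [::] -> ~~ odd (size a) -> all (leq 1) a ->
  rotundus_plus q a =
  \sum_(g : loop (Tplus a) | closed_loop g)
     q ^+ #|@enclosed_on (fan_word a) 0 b g|.
Proof.
move=> q_unit a0 even_a a_gt0.
have [has_up has_down] : has id (fan_word a) /\ has negb (fan_word a).
  case: a a0 even_a a_gt0 => [|x [|y a]] //= _ _ /and3P[x0 y0 _].
  rewrite fan_word_cons2 !has_cat; case: x x0 => // x _; case: y y0 => // y _.
  by rewrite !orbT.
rewrite rotundus_plus_word // (loop_sum_word _ _ _ _
  (X := mx22 1 q 0 q) (Y := mx22 1 0 1 q)) ?drop0 ?take0 ?mx22E //; ring.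
Qed.

Lemma rotundus_loops c b : c != [::] -> all (leq 2) c ->
  rotundus q c =
  \sum_(g : loop (Tminus c) | closed_loop g)
     q ^+ #|@enclosed_on (fan_word (fan_params c)) 1 b g|.
Proof.
move=> c0 c_gt1.
have [u [wordE has_up_u]] : exists u, fan_word (fan_params c) = false :: u /\ has id u.
  case: c c0 c_gt1 => // z c _ c_gt1; rewrite fan_word_params //; eexists; split=> //.
  by rewrite /= has_cat has_rcons.
rewrite rotundus_word // (loop_sum_word _ _ _ _
  (X := mx22 (1 + q) (- q) 1 0) (Y := mx22 q 1 0 1)) ?wordE ?mx22E //= ?take0 ?drop0 //;
  ring.
Qed.

End Annuli.

Local Open Scope ring_scope.

Theorem theorem5 (K : comUnitRingType) (q : K) (hq : q \is a GRing.unit)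
    (m : nat) (a : seq nat) (k : nat) (c : seq nat)
    (hm : (0 < m)%N) (ha : size a = (2 * m)%N)
    (ha_pos : forall x : nat, x \in a -> (0 < x)%N)
    (hk : (0 < k)%N) (hc : size c = k)
    (hc_gt1 : forall x : nat, x \in c -> (1 < x)%N) :
  [/\ rotundus_plus q a = \sum_(g : loop (Tplus a) | closed_loop g) q ^+ ar g,
      \sum_(g : loop (Tplus a) | closed_loop g) q ^+ ar g
        = \sum_(g : loop (Tplus a) | closed_loop g) q ^+ coar g,
      rotundus q c = \sum_(g : loop (Tminus c) | closed_loop g) q ^+ ar g
    & \sum_(g : loop (Tminus c) | closed_loop g) q ^+ ar g
        = \sum_(g : loop (Tminus c) | closed_loop g) q ^+ coar g].
Proof.
have a0 : a != [::] by rewrite -size_eq0 ha; lia.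
have even_a : ~~ odd (size a) by rewrite ha mul2n odd_double.
have a_gt0 : all (leq 1) a by apply/allP.
have c0 : c != [::] by rewrite -size_eq0 hc -lt0n.
have c_gt1 : all (leq 2) c by apply/allP.
have plus b := rotundus_plus_loops b hq a0 even_a a_gt0.
have minus b := rotundus_loops q b c0 c_gt1.
split; [exact: (plus true) | | exact: (minus true) |].
  exact: etrans (esym (plus true)) (plus false).
exact: etrans (esym (minus true)) (minus false).
Qed.
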